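(* Let $q$ be a power of a prime $p\ge5$. Let $(s,t),(s',t')\in\mathbb F_q^2$ with $t(1+s+t)\neq0$, $t'(1+s'+t')\neq0$, such that $f_{s,t}$ and $f_{s',t'}$ are equivalent and \[ G_{s,t}=(X^2+a_1X+a_0)(X^2+b_1X+b_0),\qquad G_{s',t'}=(X^2+a_1'X+a_0')(X^2+b_1'X+b_0'), \] where in each factorization the two quadratic factors are distinct and irreducible over $\mathbb F_q$. Then $M(a_0,a_1)=M(a_0',a_1')$, where \[ M(X,Y)=\frac{(Y^2-4X)(2+2X+Y)}{Y(2+Y)(2X+Y)}. \]
   Context: $\mathbb F_q$ is the field with $q$ elements. For $s,t\in\mathbb F_q$ with $t(1+s+t)\ne0$, $f_{s,t}=\frac{X^3+sX+t}{X(X-1)}$ and $G_{s,t}(X)=X^4-2X^3-sX^2-2tX+t$. $\mathrm{PGL}(2,\mathbb F_q)$ is the group of rational functions $(aX+b)/(cX+d)$ with $ad-bc\ne0$ under composition; $f,g$ are equivalent if $g=\psi\circ f\circ\phi$ for some $\psi,\phi\in\mathrm{PGL}(2,\mathbb F_q)$. *)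

(* Defs.v *)
From HB Require Import structures.
From mathcomp Require Import all_boot all_order all_algebra.
From mathcomp Require Import ring.

Set Implicit Arguments.
Unset Strict Implicit.
Unset Printing Implicit Defensive.

Import GRing.Theory.
Local Open Scope ring_scope.
Local Open Scope quotient_scope.

Local Notation "x %:F" := (@FracField.tofrac _ x).

Notation ratfun F := {fraction {poly F}}.

Definition ratX (F : fieldType) : ratfun F := ('X : {poly F})%:F.

Definition ratC (F : fieldType) (c : F) : ratfun F := (c%:P)%:F.

Definition poly_at (F : fieldType) (n : {poly F}) (g : ratfun F) : ratfun F :=
  (map_poly (@ratC F) n).[g].

(* f \o g = n(g) / d(g), where n / d is the representative of f chosen by
   [repr]. When g is not constant, d(g) != 0 for every d != 0, so the value does
   not depend on that choice (see [ratcompE]). *)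
Definition ratcomp (F : fieldType) (f g : ratfun F) : ratfun F :=
  poly_at \n_(repr f) g / poly_at \d_(repr f) g.

Definition in_PGL2 (F : fieldType) (phi : ratfun F) : Prop :=
  exists a b c d : F, a * d - b * c != 0 /\
    phi = (ratC a * ratX F + ratC b) / (ratC c * ratX F + ratC d).

Definition rat_equiv (F : fieldType) (f g : ratfun F) : Prop :=
  exists psi phi : ratfun F, [/\ in_PGL2 psi, in_PGL2 phi
    & g = ratcomp psi (ratcomp f phi)].

Definition f_ (F : fieldType) (s t : F) : ratfun F :=
  (ratX F ^+ 3 + ratC s * ratX F + ratC t) / (ratX F * (ratX F - 1)).

Definition G_ (F : fieldType) (s t : F) : {poly F} :=
  'X^4 - 2%:R *: 'X^3 - s *: 'X^2 - (2%:R * t) *: 'X + t%:P.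

Definition quad (F : fieldType) (a1 a0 : F) : {poly F} :=
  'X^2 + a1 *: 'X + a0%:P.

(* Division is total here, but [M_denom_neq0] shows that the denominator does not
   vanish at the coefficients of an irreducible quadratic factor of G_ s t whose
   cofactor is irreducible too (t != 0, characteristic not 2). *)
Definition M_ (F : fieldType) (x y : F) : F :=
  ((y ^+ 2 - 4%:R * x) * (2%:R + 2%:R * x + y)) /
  (y * (2%:R + y) * (2%:R * x + y)).

Lemma ratfun_numden (F : fieldType) (f : ratfun F) :
  f = (\n_(repr f))%:F / (\d_(repr f))%:F.
Proof.
have d0 : (\d_(repr f))%:F != 0 :> ratfun F by rewrite tofrac_eq0 denom_ratioP.
apply: (mulIf d0); rewrite divfK //.
rewrite -{1}[f]reprK; set r := repr f; rewrite /FracField.tofrac; unlock.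
rewrite -[X in _ * X = _]/(\pi_(ratfun F) (Ratio \d_r 1)).
rewrite -[RHS]/(\pi_(ratfun F) (Ratio \n_r 1)).
rewrite -[LHS]/(FracField.mul _ _).
rewrite !piE; apply/eqmodP => /=; rewrite FracField.equivfE /FracField.mulf.
by rewrite !numden_Ratio ?oner_eq0 ?mulf_neq0 ?oner_eq0 ?denom_ratioP // !mulr1 mulrC.
Qed.

Lemma poly_atM (F : fieldType) (p q : {poly F}) (g : ratfun F) :
  poly_at (p * q) g = poly_at p g * poly_at q g.
Proof.
rewrite /poly_at -hornerM.
by rewrite -[@ratC F]/(@FracField.tofrac _ \o @polyC F) rmorphM.
Qed.

Lemma poly_at_eq0 (F : fieldType) (p : {poly F}) (g : ratfun F) :
  (forall c : F, g != ratC c) -> (poly_at p g == 0) = (p == 0).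
Proof.
move=> gnc; apply/idP/eqP => [|->]; last first.
  by rewrite /poly_at map_poly0 horner0.
move=> pg0; apply/eqP; apply: contraLR pg0 => p0.
have [k [q]] := multiplicity_XsubC p 0.
rewrite p0 /= => q0 pE.
have -> : poly_at p g = poly_at q g * g ^+ k.
  rewrite pE poly_atM subr0 /poly_at.
  rewrite -[@ratC F]/(@FracField.tofrac _ \o @polyC F).
  by rewrite map_polyXn hornerXn.
have g0 : g != 0 by apply: contra (gnc 0) => /eqP ->; rewrite /ratC !rmorph0.
apply: mulf_neq0; last by apply: expf_neq0.
move: (ratfun_numden g) (denom_ratioP (repr g)).
set n0 := \n_(repr g); set d0 := \d_(repr g) => gE d0_neq0.
pose h := gcdp n0 d0.
have h0 : h != 0 by rewrite gcdp_eq0 negb_and d0_neq0 orbT.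
pose n := n0 %/ h; pose d := d0 %/ h.
have nE : n0 = n * h by rewrite divpK // dvdp_gcdl.
have dE : d0 = d * h by rewrite divpK // dvdp_gcdr.
have d_neq0 : d != 0 by apply: contraNneq d0_neq0 => d_0; rewrite dE d_0 mul0r.
have cnd : coprimep n d by rewrite coprimep_div_gcd // d0_neq0 orbT.
have dF0 : d%:F != 0 :> ratfun F by rewrite tofrac_eq0.
have {}gE : g = n%:F / d%:F.
  have hF0 : h%:F != 0 :> ratfun F by rewrite tofrac_eq0.
  by rewrite gE nE dE !tofracM -mulf_div (divff hF0) mulr1.
have q_neq0 : q != 0 by apply: contraNneq q0 => ->; rewrite root0.
case sq : (size q) => [|m].
  by exfalso; move: q_neq0; rewrite -size_poly_eq0 sq eqxx.
pose H := \sum_(i < m.+1) q`_i *: (n ^+ i * d ^+ (m - i)).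
have HE : H%:F = d%:F ^+ m * poly_at q g :> ratfun F.
  have key (K : fieldType) (c x y z : K) :
      y != 0 -> c * (x * z) = y * z * (c * (x / y)).
    by move=> y0; field.
  have ratC0 : ratC (0 : F) = 0 by rewrite /ratC !rmorph0.
  have rinj : injective (@ratC F).
    by move=> x y /eqP; rewrite /ratC tofrac_eq => /eqP /polyC_inj.
  rewrite /poly_at horner_coef (size_map_inj_poly rinj ratC0).
  rewrite sq rmorph_sum big_distrr; apply: eq_bigr => i _ /=.
  rewrite (coef_map_id0 _ _ ratC0).
  rewrite -mul_polyC !tofracM !tofracXn gE exprMn exprVn /ratC.
  have -> : d%:F ^+ m = d%:F ^+ i * d%:F ^+ (m - i) :> ratfun F.
    by rewrite -exprD subnKC // -ltnS.
  exact/key/expf_neq0.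
apply/negP => /eqP qg0; move/eqP: HE; rewrite qg0 mulr0 tofrac_eq0 => /eqP H0.
have qc0 : q`_0 != 0 by rewrite -horner_coef0.
have qcm : q`_m != 0 by move: q_neq0; rewrite -lead_coef_eq0 lead_coefE sq.
have n1 : n %| d ^+ m.
  rewrite -(dvdpZr _ _ qc0).
  move: H0; rewrite /H big_ord_recl /= expr0 mul1r subn0 => /eqP.
  rewrite addr_eq0 => /eqP ->; rewrite dvdpNr.
  apply: (big_ind (fun z => n %| z)) => [|x y|i _]; [exact: dvdp0 | exact: dvdp_add|].
  by rewrite -mul_polyC dvdp_mull // exprS -mulrA dvdp_mulr.
have d1 : d %| n ^+ m.
  rewrite -(dvdpZr _ _ qcm).
  move: H0; rewrite /H big_ord_recr /= subnn expr0 mulr1 addrC => /eqP.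
  rewrite addr_eq0 => /eqP ->; rewrite dvdpNr.
  apply: (big_ind (fun z => d %| z)) => [|x y|i _]; [exact: dvdp0 | exact: dvdp_add|].
  rewrite -mul_polyC dvdp_mull // dvdp_mull //.
  by rewrite -(@prednK (m - i)) ?subn_gt0 ?ltn_ord // exprS dvdp_mulr.
have sn : size n == 1%N.
  by rewrite -dvdp1 -(Gauss_dvdpr 1 (coprimep_expr m cnd)) mulr1.
have sd : size d == 1%N.
  have cdn : coprimep d n by rewrite coprimep_sym.
  by rewrite -dvdp1 -(Gauss_dvdpr 1 (coprimep_expr m cdn)) mulr1.
case/size_poly1P: sn => a _ na; case/size_poly1P: sd => b b0 db.
case/negP: (gnc (a / b)); rewrite gE na db /ratC polyCM tofracM.
have bF0 : (b%:P)%:F != 0 :> ratfun F by rewrite -db.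
apply/eqP; congr (_ * _); apply: (mulIf bF0).
by rewrite mulVf // -tofracM -polyCM mulVf // tofrac1.
Qed.

Lemma ratcompE (F : fieldType) (n d : {poly F}) (g : ratfun F) :
  (forall c : F, g != ratC c) -> d != 0 ->
  ratcomp (n%:F / d%:F) g = poly_at n g / poly_at d g.
Proof.
move=> gnc d0; rewrite /ratcomp.
move: (ratfun_numden (n%:F / d%:F)) (denom_ratioP (repr (n%:F / d%:F))).
set N := \n_(repr _); set D := \d_(repr _) => /eqP E D0.
have dF0 : d%:F != 0 :> ratfun F by rewrite tofrac_eq0.
have DF0 : D%:F != 0 :> ratfun F by rewrite tofrac_eq0.
move: E; rewrite (eqr_div _ _ dF0 DF0) -!tofracM tofrac_eq => /eqP E.
have dg0 : poly_at d g != 0 by rewrite poly_at_eq0.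
have Dg0 : poly_at D g != 0 by rewrite poly_at_eq0.
by apply/eqP; rewrite (eqr_div _ _ Dg0 dg0) -!poly_atM E.
Qed.

Lemma quad_10_reducible (F : fieldType) : ~ irreducible_poly (quad (- 2%:R : F) 1).
Proof.
have E : quad (- 2%:R : F) 1 = ('X - 1%:P) * ('X - 1%:P).
  by rewrite /quad -mul_polyC polyCN polyCMn; ring.
rewrite E => -[_ /(_ ('X - 1%:P))]; rewrite size_XsubC => /(_ isT (dvdp_mulr _ (dvdpp _))).
move=> /eqp_size; rewrite size_XsubC size_mul ?polyXsubC_eq0 // !size_XsubC //.
Qed.

Lemma M_denom_neq0 (F : fieldType) (s t a0 a1 b0 b1 : F) :
  2%:R != 0 :> F -> t != 0 -> G_ s t = quad a1 a0 * quad b1 b0 ->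
  irreducible_poly (quad a1 a0) -> irreducible_poly (quad b1 b0) ->
  a1 * (2%:R + a1) * (2%:R * a0 + a1) != 0.
Proof.
move=> two0 t0 E Ia Ib.
have QE : quad a1 a0 * quad b1 b0 = 'X^4 + (a1 + b1) *: 'X^3
    + (a0 + b0 + a1 * b1) *: 'X^2 + (a1 * b0 + a0 * b1) *: 'X + (a0 * b0)%:P.
  by rewrite /quad -!mul_polyC !(polyCD, polyCM); ring.
move: E; rewrite QE /G_ => E.
have c i := congr1 (fun p : {poly F} => p`_i) E.
have := c 0%N; have := c 1%N; have := c 3%N.
rewrite !(coefD, coefB, coefN, coefZ, coefXn, coefX, coefC) /=.
rewrite !(mulr0, mulr1, addr0, add0r, subr0, sub0r, oppr0) => e3 e1 e0.
have a00 : a0 != 0 by apply: contraNneq t0 => a00; rewrite e0 a00 mul0r.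
have b1E : b1 = - 2%:R - a1 by rewrite e3; ring.
have K : a0 * b1 + a1 * b0 + 2%:R * a0 * b0 = 0.
  have -> : a0 * b1 + a1 * b0 = - (2%:R * t) by rewrite e1; ring.
  by rewrite e0; ring.
have nA : (a1 == - 2%:R) && (a0 == 1) = false.
  by apply/negP => /andP [/eqP A /eqP B]; move: Ia; rewrite A B; apply: quad_10_reducible.
have nB : (b1 == - 2%:R) && (b0 == 1) = false.
  by apply/negP => /andP [/eqP A /eqP B]; move: Ib; rewrite A B; apply: quad_10_reducible.
apply/negP; rewrite !mulf_eq0 -orbA => /or3P[/eqP A|/eqP A|/eqP A].
- move: nB; rewrite b1E A subr0 eqxx /= => /eqP; apply.
  apply: (mulfI (mulf_neq0 two0 a00)); apply/eqP; rewrite -subr_eq0 -K b1E A.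
  by apply/eqP; ring.
- have a1E : a1 = - 2%:R by apply/eqP; rewrite -addr_eq0 addrC A.
  move: nA; rewrite a1E eqxx /= => /eqP; apply.
  have : 2%:R * b0 * (a0 - 1) = 0 by rewrite -[RHS]K b1E a1E; ring.
  move/eqP; rewrite !mulf_eq0 (negPf two0) /= => /orP[/eqP b00|].
    by move: t0; rewrite e0 b00 mulr0 eqxx.
  by rewrite subr_eq0 => /eqP.
- have a1E : a1 = - (2%:R * a0) by apply/eqP; rewrite -addr_eq0 addrC A.
  have : 2%:R * a0 * (a0 - 1) = 0 by rewrite -[RHS]K b1E a1E; ring.
  move/eqP; rewrite !mulf_eq0 (negPf two0) (negPf a00) /= subr_eq0 => /eqP a01.
  by move: nA; rewrite a1E a01 mulr1 !eqxx.
Qed.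

(* Main.v *)
Require Import Defs.
From mathcomp Require Import all_boot all_order all_algebra.
From mathcomp Require Import finfield ring zify.
Import GRing.Theory.
Local Open Scope ring_scope.
Local Notation "x %:F" := (@FracField.tofrac _ x).

(** A cubic rational function n / d spans, up to postcomposition, a pencil of
    binary cubics, determined by its two Pluecker covariants: the Wronskian of
    (n, d), a binary quartic, and its third transvectant, a scalar. For f_ s t
    these are G_ s t and 2 s. When the quartic is a product A B of quadratics,
    [9 disc(A) disc(B) / (2 s + polar(A, B))^2] is invariant under substitution
    by PGL2, rescaling of the pencil and exchange of A and B; the relations
    that G_ s t = A B imposes on the coefficients turn it into M_ a0 a1. Unique
    factorization matches the factors of the two quartics. *)

(** * Covariants of pairs of polynomials, and homogenized forms *)

Definition wronskian {F : fieldType} (p q : {poly F}) : {poly F} :=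
  p^`() * q - p * q^`().

(** Up to a constant factor, the apolarity pairing of two binary cubics, dehomogenized: its formal
    derivative telescopes to terms containing a fourth derivative. *)
Definition transvectant3 {F : fieldType} (p q : {poly F}) : {poly F} :=
  p^`()^`()^`() * q - p^`()^`() * q^`() + p^`() * q^`()^`()
  - p * q^`()^`()^`().

Definition quad_disc {F : fieldType} (p : {poly F}) : {poly F} :=
  p^`() ^+ 2 - 2%:R * (p * p^`()^`()).

(** The polarization of minus the discriminant: on the diagonal it is [- quad_disc p]. *)
Definition quad_polar {F : fieldType} (p q : {poly F}) : {poly F} :=
  p * q^`()^`() - p^`() * q^`() + p^`()^`() * q.

Definition lin {F : fieldType} (a b : F) : {poly F} := a%:P * 'X + b%:P.

(* The suffix [h] marks homogenized forms, evaluated at two polynomials: [x = 'X]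
   and [y = 1] give the forms themselves, [x = lin a b] and [y = lin c d] their
   substitution by a Moebius map with denominators cleared. *)
Definition numh {F : fieldType} (s t : F) (x y : {poly F}) : {poly F} :=
  x ^+ 3 + s%:P * x * y ^+ 2 + t%:P * y ^+ 3.

Definition denh {F : fieldType} (x y : {poly F}) : {poly F} := x * y * (x - y).

Definition quadh {F : fieldType} (u v : F) (x y : {poly F}) : {poly F} :=
  x ^+ 2 + u%:P * x * y + v%:P * y ^+ 2.

Definition Gh {F : fieldType} (s t : F) (x y : {poly F}) : {poly F} :=
  x ^+ 4 - 2%:R * x ^+ 3 * y - s%:P * x ^+ 2 * y ^+ 2
  - 2%:R * t%:P * x * y ^+ 3 + t%:P * y ^+ 4.

(** * Transformation rules of the covariants *)

Lemma deriv_lin {F : fieldType} (a b : F) : (lin a b)^`() = a%:P.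
Proof. by rewrite /lin !derivE; ring. Qed.

Lemma lin10 {F : fieldType} : lin 1 0 = 'X :> {poly F}.
Proof. by rewrite /lin; ring. Qed.

Lemma lin01 {F : fieldType} : lin 0 1 = 1 :> {poly F}.
Proof. by rewrite /lin; ring. Qed.

Definition pderivE {F : fieldType} :=
  (@deriv_lin F, derivD, derivB, derivM, derivN, derivXn, derivX, derivC, derivZ).

(** The Wronskian is bilinear and alternating, so a change of basis of the pencil multiplies it by
    the determinant; the same argument serves [transvectant3]. *)
Lemma wronskian_comb {F : fieldType} (a b c d : F) (p q : {poly F}) :
  wronskian (a%:P * p + b%:P * q) (c%:P * p + d%:P * q) =
  (a * d - b * c)%:P * wronskian p q.
Proof. by rewrite /wronskian !pderivE; ring. Qed.

Lemma transvectant3_comb {F : fieldType} (a b c d : F) (p q : {poly F}) :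
  transvectant3 (a%:P * p + b%:P * q) (c%:P * p + d%:P * q) =
  (a * d - b * c)%:P * transvectant3 p q.
Proof. by rewrite /transvectant3 !pderivE; ring. Qed.

(** The identity substitution shows that [G_ s t] is the numerator of the derivative of [f_ s t].
    The exponent of the determinant is the weight of the covariant: 1 here, 3 for [transvectant3], 2
    for the discriminant and its polarization. *)
Lemma wronskian_sub {F : fieldType} (s t a b c d : F) :
  wronskian (numh s t (lin a b) (lin c d)) (denh (lin a b) (lin c d)) =
  (a * d - b * c)%:P * Gh s t (lin a b) (lin c d).
Proof.
rewrite /wronskian /numh /denh /Gh !exprS !expr0 !pderivE /lin; ring.
Qed.

Lemma transvectant3_sub {F : fieldType} (s t a b c d : F) :
  transvectant3 (numh s t (lin a b) (lin c d)) (denh (lin a b) (lin c d)) =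
  ((a * d - b * c) ^+ 3 * (2%:R * s))%:P.
Proof.
rewrite /transvectant3 /numh /denh.
rewrite !exprS !expr0 !pderivE.
rewrite /lin !mul0r !mulr0 !add0r !addr0.
ring.
Qed.

Lemma quad_disc_sub {F : fieldType} (u v a b c d : F) :
  quad_disc (quadh u v (lin a b) (lin c d)) =
  ((a * d - b * c) ^+ 2 * (u ^+ 2 - 4%:R * v))%:P.
Proof. by rewrite /quad_disc /quadh !exprS !expr0 !pderivE /lin; ring. Qed.

Lemma quad_polar_sub {F : fieldType} (u v u' v' a b c d : F) :
  quad_polar (quadh u v (lin a b) (lin c d)) (quadh u' v' (lin a b) (lin c d)) =
  ((a * d - b * c) ^+ 2 * (2%:R * (v + v') - u * u'))%:P.
Proof. by rewrite /quad_polar /quadh !exprS !expr0 !pderivE /lin; ring. Qed.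

Lemma quad_discZ {F : fieldType} (e : F) (p : {poly F}) :
  quad_disc (e%:P * p) = (e ^+ 2)%:P * quad_disc p.
Proof. by rewrite /quad_disc !pderivE; ring. Qed.

Lemma quad_polarZ {F : fieldType} (e f : F) (p q : {poly F}) :
  quad_polar (e%:P * p) (f%:P * q) = (e * f)%:P * quad_polar p q.
Proof. by rewrite /quad_polar !pderivE; ring. Qed.

(** * Evaluation at a rational function, and Moebius maps *)

Lemma poly_atE {F : fieldType} (p q : {poly F}) (c : F) (g : {fraction {poly F}}) :
  [/\ poly_at (p + q) g = poly_at p g + poly_at q g,
      poly_at c%:P g = ratC c & poly_at 'X g = g].
Proof.
rewrite /poly_at -[@ratC F]/(@FracField.tofrac _ \o @polyC F).
by rewrite rmorphD hornerD map_polyC map_polyX hornerC hornerX.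
Qed.

Lemma poly_atD {F : fieldType} (p q : {poly F}) g :
  poly_at (p + q) g = poly_at p g + poly_at q g.
Proof. by have [] := poly_atE p q 0 g. Qed.

Lemma poly_atC {F : fieldType} (c : F) g : poly_at c%:P g = ratC c.
Proof. by have [] := poly_atE 0 0 c g. Qed.

Lemma poly_atX {F : fieldType} (g : {fraction {poly F}}) : poly_at 'X g = g.
Proof. by have [] := poly_atE 0 0 0 g. Qed.

Lemma ratCN {F : fieldType} (a : F) : ratC (- a) = - ratC a.
Proof. by rewrite /ratC polyCN tofracN. Qed.

Lemma ratC1 {F : fieldType} : ratC (1 : F) = 1.
Proof. by rewrite /ratC tofrac1. Qed.

Lemma tofrac_lin {F : fieldType} (a b : F) :
  (lin a b)%:F = ratC a * ratX F + ratC b.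
Proof. by rewrite /lin tofracD tofracM. Qed.

Lemma lin_eq0 {F : fieldType} (a b : F) : (lin a b == 0) = (a == 0) && (b == 0).
Proof.
apply/eqP/andP => [E|[/eqP-> /eqP->]]; last by rewrite /lin; ring.
have c i := congr1 (fun p : {poly F} => p`_i) E.
have := c 1%N; have := c 0%N.
by rewrite /lin !coefD !coefCM !coefX !coefC /= mulr0 mulr1 addr0 add0r => -> ->.
Qed.

(** A constant value [e] would make [(a, b)] equal to [e] times [(c, d)], and the determinant would
    vanish. *)
Lemma mobius_nonconst {F : fieldType} (a b c d : F) : a * d - b * c != 0 ->
  forall e, (lin a b)%:F / (lin c d)%:F != ratC e.
Proof.
move=> D e; apply/eqP => E.
have l0 : lin c d != 0.
  apply: contraNneq D => /eqP; rewrite lin_eq0 => /andP[/eqP-> /eqP->].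
  by rewrite !mulr0 subr0.
have /eqP : (lin (a - e * c) (b - e * d)) = 0.
  have -> : lin (a - e * c) (b - e * d) = lin a b - e%:P * lin c d.
    by rewrite /lin !(polyCB, polyCM); ring.
  apply/eqP; rewrite -(@tofrac_eq0 {poly F}) tofracB tofracM -/(ratC e) -E divfK ?subrr //.
  by rewrite tofrac_eq0.
rewrite lin_eq0 !subr_eq0 => /andP[/eqP a_ /eqP b_].
by case/eqP: D; rewrite a_ b_; ring.
Qed.

(** If the value were [e], then [n - e d] would vanish at the nonconstant [g], which by
    [poly_at_eq0] forces [n = e d]. *)
Lemma frac_nonconst {F : fieldType} (n d : {poly F}) (g : {fraction {poly F}}) :
  (forall e, n != e%:P * d) -> d != 0 -> (forall e, g != ratC e) ->
  forall e, poly_at n g / poly_at d g != ratC e.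
Proof.
move=> nd d0 gnc e; apply/eqP => E.
have dg0 : poly_at d g != 0 by rewrite poly_at_eq0.
case/negP: (nd e); rewrite -subr_eq0 -(poly_at_eq0 _ gnc).
rewrite -mulNr -polyCN poly_atD poly_atM poly_atC ratCN.
by apply/eqP; rewrite -(divfK dg0 (poly_at n g)) E; ring.
Qed.

Lemma poly_atB {F : fieldType} (p q : {poly F}) g :
  poly_at (p - q) g = poly_at p g - poly_at q g.
Proof.
by rewrite -mulN1r -(polyC1 F) -polyCN poly_atD poly_atM poly_atC ratCN ratC1 mulN1r.
Qed.

Lemma poly_at1 {F : fieldType} (g : {fraction {poly F}}) : poly_at 1 g = 1.
Proof. by rewrite -(polyC1 F) poly_atC ratC1. Qed.

Definition poly_atR {F : fieldType} :=
  (@poly_atB F, @poly_atD F, @poly_atM F, @poly_atC F, @poly_atX F, @poly_at1 F).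

(** * The fraction [f_ s t] and its composition with a Moebius map *)

Lemma denhX1E {F : fieldType} : denh 'X 1 = 'X * ('X - 1%:P) :> {poly F}.
Proof. by rewrite /denh mulr1. Qed.

Lemma denhX1_neq0 {F : fieldType} : denh 'X 1 != 0 :> {poly F}.
Proof. by rewrite denhX1E mulf_neq0 ?polyX_eq0 ?polyXsubC_eq0. Qed.

Lemma size_denhX1 {F : fieldType} : size (denh 'X 1 : {poly F}) = 3.
Proof. by rewrite denhX1E mulrC size_mulX ?polyXsubC_eq0 // size_XsubC. Qed.

Lemma size_lin {F : fieldType} (a b : F) : (size (lin a b) <= 2)%N.
Proof. by rewrite /lin size_MXaddC; case: ifP => // _; rewrite ltnS size_polyC leq_b1. Qed.

Lemma size_numhX1 {F : fieldType} (s t : F) : size (numh s t 'X 1) = 4.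
Proof.
have -> : numh s t 'X 1 = 'X^3 + lin s t by rewrite /numh /lin; ring.
by rewrite size_polyDl size_polyXn // ltnS (leq_trans (size_lin s t)).
Qed.

(** The denominator has roots 0 and 1, where the numerator takes the values [t] and [1 + s + t]. *)
Lemma coprime_numh_denh {F : fieldType} (s t : F) : t * (1 + s + t) != 0 ->
  coprimep (numh s t 'X 1) (denh 'X 1).
Proof.
rewrite mulf_eq0 negb_or => /andP[t0 t1].
have cop x : coprimep (numh s t 'X 1) ('X - x%:P) = (x ^+ 3 + s * x + t != 0).
  by rewrite coprimep_XsubC rootE /numh !expr1n !mulr1 !hornerE.
have cop0 := cop 0; rewrite polyC0 subr0 expr0n mulr0 !add0r in cop0.
by rewrite denhX1E coprimepMr cop0 cop t0 expr1n mulr1.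
Qed.

Lemma f_homog {F : fieldType} (s t : F) :
  f_ s t = (numh s t 'X 1)%:F / (denh 'X 1)%:F.
Proof.
rewrite /f_ /ratX /ratC -(tofrac1 {poly F}) -!(tofracB, tofracM, tofracXn, tofracD).
by congr (_%:F / _%:F); rewrite /numh /denh; ring.
Qed.

Lemma tofrac_numh {F : fieldType} (s t : F) (x y : {poly F}) :
  (numh s t x y)%:F = x%:F ^+ 3 + ratC s * x%:F * y%:F ^+ 2 + ratC t * y%:F ^+ 3.
Proof. by rewrite /numh !(tofracD, tofracM, tofracXn). Qed.

Lemma tofrac_denh {F : fieldType} (x y : {poly F}) :
  (denh x y)%:F = x%:F * y%:F * (x%:F - y%:F).
Proof. by rewrite /denh !(tofracB, tofracM). Qed.

Lemma divf_div2r {K : fieldType} (x y z : K) : z != 0 -> x / z / (y / z) = x / y.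
Proof. by move=> z0; rewrite invf_div mulrA divfK. Qed.

Lemma addf_mulK {K : fieldType} (a b x y : K) :
  y != 0 -> (a * x + b * y) / y = a * (x / y) + b.
Proof. by move=> y0; rewrite mulrDl mulfK // mulrA. Qed.

Lemma poly_at_lin {F : fieldType} (x y : F) (n d : {poly F}) : d != 0 ->
  poly_at (lin x y) (n%:F / d%:F) = (x%:P * n + y%:P * d)%:F / d%:F.
Proof.
move=> d0; have dF : d%:F != 0 by rewrite tofrac_eq0.
rewrite tofracD !tofracM -/(ratC x) -/(ratC y) (addf_mulK _ _ _ _ dF).
by rewrite /lin !poly_atR.
Qed.

Lemma poly_at_numh {F : fieldType} (s t : F) (x y : {poly F}) : y != 0 ->
  poly_at (numh s t 'X 1) (x%:F / y%:F) = (numh s t x y)%:F / y%:F ^+ 3.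
Proof.
move=> y0; have yF : y%:F != 0 by rewrite tofrac_eq0.
(* [field] does not terminate on the concrete field {fraction {poly F}}. *)
have key (K : fieldType) (u v a b : K) : v != 0 ->
    (u / v) ^+ 3 + a * (u / v) + b =
    (u ^+ 3 + a * u * v ^+ 2 + b * v ^+ 3) / v ^+ 3 by move=> v0; field.
rewrite tofrac_numh -key // /numh !expr1n !mulr1 exprSr expr2 !poly_atR.
by rewrite -expr2 -exprSr.
Qed.

Lemma poly_at_denh {F : fieldType} (x y : {poly F}) : y != 0 ->
  poly_at (denh 'X 1) (x%:F / y%:F) = (denh x y)%:F / y%:F ^+ 3.
Proof.
move=> y0; have yF : y%:F != 0 by rewrite tofrac_eq0.
have key (K : fieldType) (u v : K) : v != 0 ->
    u / v * 1 * (u / v - 1) = (u * v * (u - v)) / v ^+ 3 by move=> v0; field.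
by rewrite tofrac_denh -key // /denh !poly_atR.
Qed.

Lemma numh_neq_denh {F : fieldType} (s t e : F) : numh s t 'X 1 != e%:P * denh 'X 1.
Proof.
apply: contra_eqN (size_numhX1 s t) => /eqP ->; rewrite mul_polyC.
by rewrite neq_ltn (leq_ltn_trans (size_scale_leq _ _)) // size_denhX1.
Qed.

(** Numerator and denominator are both homogenized to degree 3, so evaluating them at [phi] produces
    the same cube of [lin c d] below each, and it cancels. *)
Lemma ratcomp_f_mobius {F : fieldType} (s t a b c d : F) : a * d - b * c != 0 ->
  let phi := (lin a b)%:F / (lin c d)%:F in
  let N := numh s t (lin a b) (lin c d) in let D := denh (lin a b) (lin c d) in
  [/\ ratcomp (f_ s t) phi = N%:F / D%:F, D != 0
    & forall e, N%:F / D%:F != ratC e].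
Proof.
move=> det phi N D.
have phi_nc : forall e, phi != ratC e by exact: mobius_nonconst.
have l0 : lin c d != 0.
  apply: contraNneq det => /eqP; rewrite lin_eq0 => /andP[/eqP-> /eqP->].
  by rewrite !mulr0 subr0.
have lF : (lin c d)%:F != 0 by rewrite tofrac_eq0.
(* Up to that cube, [D] is the value of a nonzero polynomial at the nonconstant [phi]. *)
have D0 : D != 0.
  have := denhX1_neq0 (F := F); rewrite -(poly_at_eq0 _ phi_nc) poly_at_denh //.
  by rewrite mulf_eq0 negb_or tofrac_eq0 => /andP[].
have DF : D%:F != 0 by rewrite tofrac_eq0.
have E : poly_at (numh s t 'X 1) phi / poly_at (denh 'X 1) phi = N%:F / D%:F.
  rewrite poly_at_numh // poly_at_denh // -/N -/D.
  have L3 := expf_neq0 3 lF.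
  exact (divf_div2r N%:F D%:F _ L3).
split.
- rewrite f_homog ratcompE; [exact: E | exact: phi_nc | exact: denhX1_neq0].
- exact: D0.
move=> e; rewrite -E.
apply: frac_nonconst; [exact: numh_neq_denh | exact: denhX1_neq0 | exact: phi_nc].
Qed.

(** * Equivalence of fractions as equality of pencils *)

Lemma size_lin3 {F : fieldType} (x y z : {poly F}) :
  (size x <= 2)%N -> (size y <= 2)%N -> (size z <= 2)%N -> (size (x * y * z)%R <= 4)%N.
Proof.
move=> sx sy sz; have := size_polyMleq (x * y) z; have := size_polyMleq x y; lia.
Qed.

Lemma size_numh {F : fieldType} (s t : F) (x y : {poly F}) :
  (size x <= 2)%N -> (size y <= 2)%N -> (size (numh s t x y) <= 4)%N.
Proof.
move=> sx sy.
have -> : numh s t x y = x * x * x + s *: (x * y * y) + t *: (y * y * y).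
  by rewrite /numh -!mul_polyC; ring.
have scale e (z : {poly F}) : (size z <= 4)%N -> (size (e *: z)%R <= 4)%N.
  exact/leq_trans/size_scale_leq.
by do ?[apply: (leq_trans (size_polyD _ _)); rewrite geq_max; apply/andP; split];
  rewrite ?scale ?size_lin3.
Qed.

Lemma size_denh {F : fieldType} (x y : {poly F}) :
  (size x <= 2)%N -> (size y <= 2)%N -> (size (denh x y) <= 4)%N.
Proof.
move=> sx sy; apply: size_lin3 => //.
by rewrite (leq_trans (size_polyD _ _)) // geq_max sx size_polyN.
Qed.

(** The equivalence equates two fractions of polynomials of degree at most 3. The one for [(s', t')]
    is in lowest terms with a numerator of full degree 3, so the two pairs differ only by a scalar
    [k]. *)
Lemma f_equiv_pencil {F : fieldType} (s t s' t' : F) :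
  t' * (1 + s' + t') != 0 -> rat_equiv (f_ s t) (f_ s' t') ->
  exists a b c d al be ga de k : F,
    let N := numh s t (lin a b) (lin c d) in let D := denh (lin a b) (lin c d) in
    [/\ a * d - b * c != 0, al * de - be * ga != 0, k != 0,
        k%:P * numh s' t' 'X 1 = al%:P * N + be%:P * D
      & k%:P * denh 'X 1 = ga%:P * N + de%:P * D].
Proof.
move=> ok [psi [phi [[al [be [ga [de [det' ->]]]]] [a [b [c [d [det ->]]]]]]]].
rewrite -!tofrac_lin.
have [-> D0 nc] := ratcomp_f_mobius s t _ _ _ _ det.
set N := numh s t _ _ in nc *; set D := denh _ _ in D0 nc *.
have DF : D%:F != 0 by rewrite tofrac_eq0.
have l0 : lin ga de != 0.
  apply: contraNneq det' => /eqP; rewrite lin_eq0 => /andP[/eqP-> /eqP->].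
  by rewrite !mulr0 subr0.
have atl x y := poly_at_lin x y N D D0.
have Q0 : ga%:P * N + de%:P * D != 0.
  move: l0; rewrite -(poly_at_eq0 _ nc) atl.
  by rewrite mulf_eq0 negb_or tofrac_eq0 => /andP[].
rewrite ratcompE // !atl f_homog => /eqP.
set P := al%:P * N + be%:P * D in Q0 *; set Q := ga%:P * N + de%:P * D in Q0 *.
have QF : Q%:F != 0 by rewrite tofrac_eq0.
have -> : P%:F / D%:F / (Q%:F / D%:F) = P%:F / Q%:F by exact: (divf_div2r P%:F Q%:F _ DF).
rewrite eqr_div ?tofrac_eq0 ?denhX1_neq0 // -!tofracM tofrac_eq => /eqP E.
have : denh 'X 1 %| Q.
  have cop := coprime_numh_denh s' t' ok; rewrite coprimep_sym in cop.
  by rewrite -(Gauss_dvdpr _ cop) E dvdp_mull.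
rewrite dvdp_eq => /eqP; set k := Q %/ _ => Qk.
have Pk : P = k * numh s' t' 'X 1.
  by apply: (mulIf (denhX1_neq0 (F := F))); rewrite -E Qk; ring.
(* The polynomial cofactor [k] is a nonzero constant: [P] has size at most 4 and [numh s' t' 'X 1]
   has size exactly 4. *)
have k0 : k != 0 by apply: contraNneq Q0 => k0; rewrite Qk k0 mul0r.
have sP : (size P <= 4)%N.
  by rewrite /P !mul_polyC (leq_trans (size_polyD _ _)) // geq_max
    !(leq_trans (size_scale_leq _ _)) ?size_numh ?size_denh ?size_lin.
have n0 : numh s' t' 'X 1 != 0 by rewrite -size_poly_eq0 size_numhX1.
have /size1_polyC kE : (size k <= 1)%N.
  by move: sP; rewrite Pk size_mul // size_numhX1 addn4.
exists a, b, c, d, al, be, ga, de, k`_0; rewrite -kE; split=> //.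
by rewrite -polyC_eq0 -kE.
Qed.

(** * Quadratic factors of the quartic and the value of [M_] *)

Lemma G_homog {F : fieldType} (s t : F) : G_ s t = Gh s t (lin 1 0) (lin 0 1).
Proof. rewrite lin10 lin01 /G_ /Gh -!mul_polyC !(polyCD, polyCM, polyCMn); ring. Qed.

Lemma quad_homog {F : fieldType} (u v : F) : quad u v = quadh u v (lin 1 0) (lin 0 1).
Proof. by rewrite lin10 lin01 /quad /quadh -!mul_polyC; ring. Qed.

Lemma size_quad {F : fieldType} (u v : F) : size (quad u v) = 3.
Proof.
have -> : quad u v = 'X^2 + lin u v by rewrite /quad /lin -mul_polyC; ring.
rewrite size_polyDl size_polyXn // /lin size_MXaddC; case: ifP => // _.
by rewrite ltnS size_polyC; case: (_ != 0).
Qed.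

Lemma quad_neq0 {F : fieldType} (u v : F) : quad u v != 0.
Proof. by rewrite -size_poly_eq0 size_quad. Qed.

Lemma G_quad_coef {F : fieldType} (s t a0 a1 b0 b1 : F) :
  G_ s t = quad a1 a0 * quad b1 b0 ->
  [/\ a1 + b1 = - 2%:R, a0 + b0 + a1 * b1 = - s,
      a1 * b0 + a0 * b1 = - (2%:R * t) & a0 * b0 = t].
Proof.
have -> : quad a1 a0 * quad b1 b0 = 'X^4 + (a1 + b1) *: 'X^3
    + (a0 + b0 + a1 * b1) *: 'X^2 + (a1 * b0 + a0 * b1) *: 'X + (a0 * b0)%:P.
  by rewrite /quad -!mul_polyC !(polyCD, polyCM); ring.
rewrite /G_ => E; have c i := congr1 (fun p : {poly F} => p`_i) E.
have := c 0%N; have := c 1%N; have := c 2%N; have := c 3%N.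
rewrite !(coefD, coefB, coefN, coefZ, coefXn, coefX, coefC) /=.
by rewrite !(mulr0, mulr1, addr0, add0r, subr0, sub0r, oppr0) => -> -> -> ->.
Qed.

(** The factorization amounts to four relations between coefficients, and these give the homogeneous
    identity at any [x] and [y]. *)
Lemma G_quad_sub {F : fieldType} (s t a0 a1 b0 b1 : F) (x y : {poly F}) :
  G_ s t = quad a1 a0 * quad b1 b0 ->
  Gh s t x y = quadh a1 a0 x y * quadh b1 b0 x y.
Proof.
move=> /G_quad_coef[e3 e2 e1 e0].
have -> : Gh s t x y = x ^+ 4 + (- 2%:R)%:P * x ^+ 3 * y + (- s)%:P * x ^+ 2 * y ^+ 2
    + (- (2%:R * t))%:P * x * y ^+ 3 + t%:P * y ^+ 4.
  by rewrite /Gh; ring.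
have tE : t%:P = (a0 * b0)%:P by rewrite e0.
by rewrite -e3 -e2 -e1 tE /quadh; ring.
Qed.

Definition quad_pair_inv {F : fieldType} (s a0 a1 b0 b1 : F) : F :=
  9%:R * (a1 ^+ 2 - 4%:R * a0) * (b1 ^+ 2 - 4%:R * b0) /
    (2%:R * s + (2%:R * (a0 + b0) - a1 * b1)) ^+ 2.

Lemma M_quad {F : fieldType} (s t a0 a1 b0 b1 : F) :
  2%:R != 0 :> F -> 3%:R != 0 :> F -> t != 0 ->
  G_ s t = quad a1 a0 * quad b1 b0 ->
  irreducible_poly (quad a1 a0) -> irreducible_poly (quad b1 b0) ->
  2%:R * s + (2%:R * (a0 + b0) - a1 * b1) != 0 /\
  M_ a0 a1 = quad_pair_inv s a0 a1 b0 b1.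
Proof.
move=> two0 three0 t0 G Ia Ib.
have := M_denom_neq0 two0 t0 G Ia Ib.
rewrite !mulf_eq0 !negb_or => /andP[/andP[a1_0 a1_2] a01].
have [e3 e2 e1 e0] := G_quad_coef _ _ _ _ _ _ G.
have b1E : b1 = - (2%:R + a1) by rewrite -(addKr a1 b1) e3; ring.
(* The linear coefficient of the quartic is minus twice the constant one; eliminating [t] and then
   [b1] leaves a linear equation for [b0]. *)
have b0E : b0 = a0 * (2%:R + a1) / (2%:R * a0 + a1).
  apply: (mulIf a01); rewrite divfK //.
  have : a1 * b0 + a0 * b1 + 2%:R * (a0 * b0) = 0 by rewrite e1 e0; ring.
  by rewrite b1E => H; apply/eqP; rewrite -subr_eq0 -H; apply/eqP; ring.
have sE : s = - (a0 + b0 + a1 * b1) by rewrite e2 opprK.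
(* The sum collapses to [- 3 a1 b1]; its square explains the factor 9 in [quad_pair_inv]. *)
have cE : 2%:R * s + (2%:R * (a0 + b0) - a1 * b1) = 3%:R * (a1 * (2%:R + a1)).
  by rewrite sE b1E; ring.
split; first by rewrite cE !mulf_neq0.
rewrite /M_ /quad_pair_inv cE b1E b0E; field.
by rewrite a1_0 a1_2 a01 three0.
Qed.

(** * Matching two factorizations up to scalars *)

Lemma irreducible_dvdpM {F : fieldType} (p q r : {poly F}) :
  irreducible_poly p -> p %| q * r -> (p %| q) || (p %| r).
Proof.
move=> Ip pqr; case: (boolP (p %| q)) => //= npq.
by rewrite -(Gauss_dvdpr r (q := q)) // irreducible_poly_coprime.
Qed.

(** The irreducible [p'] divides [p] or [q], and the size bounds make the quotient a scalar.
    Cancelling [p'] then determines the other factor. *)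
Lemma factor_match {F : fieldType} (p q p' q' : {poly F}) (r : F) :
  p' * q' = r%:P * (p * q) -> p' != 0 -> q' != 0 -> irreducible_poly p' ->
  (size p <= size p')%N -> (size q <= size p')%N ->
  exists l m : F, [/\ r * (l * m) = 1 &
    (p = l%:P * p' /\ q = m%:P * q') \/ (q = l%:P * p' /\ p = m%:P * q')].
Proof.
move=> E p0 q0 Ip sp sq.
have r0 : r != 0.
  by apply: contra_neq (mulf_neq0 p0 q0) => r0; rewrite E r0 mul0r.
have main x y : p' * q' = r%:P * (x * y) -> (size x <= size p')%N -> p' %| x ->
    exists l m : F, [/\ r * (l * m) = 1, x = l%:P * p' & y = m%:P * q'].
  move=> Exy sx; rewrite dvdp_eq => /eqP xE.
  have x0 : x != 0.
    by apply: contra_neq (mulf_neq0 p0 q0) => x0; rewrite Exy x0 mul0r mulr0.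
  set k := x %/ p' in xE; have k0 : k != 0.
    by apply: contraNneq x0 => k0; rewrite xE k0 mul0r.
  have /size1_polyC kE : (size k <= 1)%N.
    move: sx (p0); rewrite xE size_mul // -(size_poly_gt0 p').
    by move: (size k) (size p') => u v; lia.
  rewrite kE polyC_eq0 in k0.
  (* Cancelling [p'] gives [q' = r k y], which dictates the second scalar. *)
  exists k`_0, (r * k`_0)^-1; split; [|by rewrite -kE|].
    by rewrite mulrA divff // mulf_neq0.
  have -> : q' = (r * k`_0)%:P * y.
    by apply: (mulfI p0); rewrite Exy xE kE coefC eqxx polyCM; ring.
  by rewrite mulrA -polyCM mulVf ?mul1r // mulf_neq0.
have : p' %| p * q.
  by rewrite -(dvdpZr _ _ r0) -mul_polyC -E dvdp_mulr.
case/(irreducible_dvdpM _ _ _ Ip)/orP => [dp|dq].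
  by have [l [m [lm ? ?]]] := main _ _ E sp dp; exists l, m; split=> //; left.
have [l [m [lm ? ?]]] := main q p (etrans E (congr1 _ (mulrC _ _))) sq dq.
by exists l, m; split=> //; right.
Qed.

(** * Transport of the quartic and of the invariant along an equivalence *)

Lemma f_equiv_G {F : fieldType} (s t s' t' : F) : 2%:R != 0 :> F ->
  t' * (1 + s' + t') != 0 -> rat_equiv (f_ s t) (f_ s' t') ->
  exists a b c d r : F, let e := a * d - b * c in
    [/\ e != 0, G_ s' t' = r%:P * Gh s t (lin a b) (lin c d)
      & s' = r * e ^+ 2 * s].
Proof.
move=> two0 ok /(f_equiv_pencil _ _ _ _ ok).
case=> a [b [c [d [al [be [ga [de [k [det det' k0 En Ed]]]]]]]]].
(* [Z] and [Z'] pad a multiple of one basis form to a combination of both, the shape that the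
   [_comb] lemmas expect. *)
have Z x : x%:P * denh 'X 1 = 0%:P * numh s' t' 'X 1 + x%:P * denh 'X 1 by ring.
have Z' x : x%:P * numh s' t' 'X 1 = x%:P * numh s' t' 'X 1 + 0%:P * denh 'X 1 by ring.
have W := wronskian_comb al be ga de (numh s t (lin a b) (lin c d)) (denh (lin a b) (lin c d)).
have T := transvectant3_comb al be ga de (numh s t (lin a b) (lin c d)) (denh (lin a b) (lin c d)).
(* Viewing ['X] and [1] as the identity substitution lets one lemma compute both sides. *)
rewrite -En -Ed Z Z' wronskian_comb wronskian_sub -lin10 -lin01 wronskian_sub -G_homog in W.
rewrite -En -Ed Z Z' transvectant3_comb transvectant3_sub -lin10 -lin01 transvectant3_sub in T.
rewrite !(mul0r, mulr0, mul1r, mulr1, subr0, polyC1) in W.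
rewrite -!polyCM !(mul0r, mulr0, mul1r, mulr1, subr0, expr1n) in T.
have kP : k%:P != 0 by rewrite polyC_eq0.
pose e := a * d - b * c; pose e' := al * de - be * ga.
(* The two covariants give [k^2 G' = e' e Gh] and [k^2 (2 s') = e' e^3 (2 s)], where [G'] is
   [G_ s' t']; the extra [e^2] is the difference of the weights 3 and 1. *)
exists a, b, c, d, (e' * e / k ^+ 2); split=> //.
  apply: (mulfI (mulf_neq0 kP kP)); rewrite -polyCM W -/e -/e'.
  rewrite !mulrA -!polyCM; congr (_%:P * _); field. exact: k0.
move: T => /polyC_inj T.
apply: (mulfI (mulf_neq0 (mulf_neq0 k0 k0) two0)).
rewrite -[LHS]mulrA T -/e -/e'; field; exact: k0.
Qed.

Lemma quad_pair_invC {F : fieldType} (s a0 a1 b0 b1 : F) :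
  quad_pair_inv s a0 a1 b0 b1 = quad_pair_inv s b0 b1 a0 a1.
Proof. by rewrite /quad_pair_inv; congr (_ / _ ^+ 2); ring. Qed.

(** With [e] the determinant, [e^2] times the discriminants and the denominator's base on the
    unprimed side equals [l^2], [m^2] and [l m] times those on the primed side. For the term [2 s]
    this uses [r (l m) = 1]. All scalars then cancel in the quotient. *)
Lemma quad_pair_inv_sub {F : fieldType}
    (s s' a0 a1 b0 b1 a0' a1' b0' b1' a b c d r l m : F) :
  a * d - b * c != 0 -> r * (l * m) = 1 -> s' = r * (a * d - b * c) ^+ 2 * s ->
  quadh a1 a0 (lin a b) (lin c d) = l%:P * quad a1' a0' ->
  quadh b1 b0 (lin a b) (lin c d) = m%:P * quad b1' b0' ->
  2%:R * s + (2%:R * (a0 + b0) - a1 * b1) != 0 ->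
  2%:R * s' + (2%:R * (a0' + b0') - a1' * b1') != 0 ->
  quad_pair_inv s a0 a1 b0 b1 = quad_pair_inv s' a0' a1' b0' b1'.
Proof.
move=> det rlm sE Ea Eb S0 S0'.
have := quad_polar_sub a1 a0 b1 b0 a b c d.
have := quad_disc_sub b1 b0 a b c d; have := quad_disc_sub a1 a0 a b c d.
rewrite Ea Eb !quad_discZ quad_polarZ !quad_homog !quad_disc_sub quad_polar_sub.
rewrite !(mulr1, mulr0, subr0, expr1n, mul1r) -!polyCM.
move=> /polyC_inj Da /polyC_inj Db /polyC_inj P.
have lms : (l * m) * (2%:R * s') = (a * d - b * c) ^+ 2 * (2%:R * s).
  by rewrite sE -[RHS]mul1r -rlm; ring.
rewrite /quad_pair_inv; move: det S0 S0' lms P Da Db.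
set e := a * d - b * c; set Q := _ - a1 * b1; set Q' := _ - a1' * b1'.
set x := a1 ^+ 2 - _; set y := b1 ^+ 2 - _.
set x' := a1' ^+ 2 - _; set y' := b1' ^+ 2 - _.
clearbody e Q Q' x y x' y'; move=> e0 S0 S0' lms P Da Db.
have SE : e ^+ 2 * (2%:R * s + Q) = (l * m) * (2%:R * s' + Q').
  by rewrite mulrDr mulrDr lms P.
apply/eqP; rewrite eqr_div ?expf_neq0 //; apply/eqP.
(* The factor [e^4] supplies one [e^2] for each discriminant on one side and for each copy of the
   denominator's base on the other. *)
apply: (mulfI (expf_neq0 4 e0)).
have -> : e ^+ 4 * (9%:R * x * y * (2%:R * s' + Q') ^+ 2) =
    9%:R * (e ^+ 2 * x) * (e ^+ 2 * y) * (2%:R * s' + Q') ^+ 2 by ring.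
have -> : e ^+ 4 * (9%:R * x' * y' * (2%:R * s + Q) ^+ 2) =
    9%:R * x' * y' * (e ^+ 2 * (2%:R * s + Q)) ^+ 2 by ring.
by rewrite SE -Da -Db; ring.
Qed.

Lemma size_quadh_lin {F : fieldType} (u v a b c d : F) :
  (size (quadh u v (lin a b) (lin c d)) <= 3)%N.
Proof.
have -> : quadh u v (lin a b) (lin c d) =
   (lin (a ^+ 2 + u * a * c + v * c ^+ 2)
        (2%:R * a * b + u * (a * d + b * c) + 2%:R * v * c * d)) * 'X
   + (b ^+ 2 + u * b * d + v * d ^+ 2)%:P by rewrite /quadh /lin; ring.
rewrite size_MXaddC; case: ifP => // _; rewrite ltnS.
rewrite /lin size_MXaddC; case: ifP => // _; rewrite ltnS size_polyC; exact: leq_b1.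
Qed.

(** * Invariance of [M_] under equivalence *)

Theorem theorem6p16 (p k : nat) (F : finFieldType)
    (s t s' t' a0 a1 b0 b1 a0' a1' b0' b1' : F)
    (p_prime : prime p) (p_ge5 : (5 <= p)%N) (cardF : #|F| = (p ^ k)%N)
    (st_ok : t * (1 + s + t) != 0) (st'_ok : t' * (1 + s' + t') != 0)
    (f_equiv : rat_equiv (f_ s t) (f_ s' t'))
    (G_fact : G_ s t = quad a1 a0 * quad b1 b0)
    (G'_fact : G_ s' t' = quad a1' a0' * quad b1' b0')
    (G_distinct : quad a1 a0 <> quad b1 b0)
    (G'_distinct : quad a1' a0' <> quad b1' b0')
    (G_irr_a : irreducible_poly (quad a1 a0))
    (G_irr_b : irreducible_poly (quad b1 b0))
    (G'_irr_a : irreducible_poly (quad a1' a0'))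
    (G'_irr_b : irreducible_poly (quad b1' b0')) :
  M_ a0 a1 = M_ a0' a1'.
Proof.
have char_p := card_finPcharP cardF p_prime.
have small0 n : (0 < n < 5)%N -> n%:R != 0 :> F.
  case/andP=> n0 n5; rewrite -(dvdn_pcharf char_p) gtnNdvd //.
  exact: leq_trans n5 p_ge5.
have two0 : 2%:R != 0 :> F by exact: small0.
have three0 : 3%:R != 0 :> F by exact: small0.
have t0 : t != 0 by move: st_ok; rewrite mulf_eq0 negb_or => /andP[].
have t'0 : t' != 0 by move: st'_ok; rewrite mulf_eq0 negb_or => /andP[].
have [S0 ->] := M_quad _ _ _ _ _ _ two0 three0 t0 G_fact G_irr_a G_irr_b.
have [S0' ->] := M_quad _ _ _ _ _ _ two0 three0 t'0 G'_fact G'_irr_a G'_irr_b.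
have [a [b [c [d [r [e0 Gsub sE]]]]]] := f_equiv_G _ _ _ _ two0 st'_ok f_equiv.
rewrite G'_fact (G_quad_sub _ _ _ _ _ _ _ _ G_fact) in Gsub.
have [||l [m [rlm [[Ea Eb]|[Eb Ea]]]]] :=
  factor_match _ _ _ _ _ Gsub (quad_neq0 _ _) (quad_neq0 _ _) G'_irr_a.
- by rewrite size_quad size_quadh_lin.
- by rewrite size_quad size_quadh_lin.
- exact: quad_pair_inv_sub e0 rlm sE Ea Eb S0 S0'.
(* The factors are matched crosswise here, so the symmetry of the invariant is applied first. *)
rewrite quad_pair_invC.
apply: quad_pair_inv_sub e0 rlm sE Eb Ea _ S0'.
by rewrite (addrC b0) (mulrC b1).
Qed.
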